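(* Let $(E,\Lambda)$ be a linear $\tau$-periodic Lagrangian system with Poincaré map $P$, let $V\subset\operatorname{Ker}(P-I)$ be an isotropic subspace of dimension $k$, $\Gamma$ the corresponding space of $\tau$-periodic solutions, and assume that $\dim F_t=k$ for all $t$, where $F_t=\{\zeta(t):\zeta\in\Gamma\}$. Let $\xi(t)\in E_t$ be a solution of the system $(E,\Lambda)$ such that $I(\xi,D\xi)\equiv0$. Then $\eta(t)=\Pi\xi(t)\in E_t^\perp$ is a solution of the system $(E^\perp,\Lambda^\perp)$. Conversely, if $\eta(t)$ is a solution of the system $(E^\perp,\Lambda^\perp)$, then there exists a solution $\xi(t)$ of the system $(E,\Lambda)$, defined modulo $\Gamma$, such that $I(\xi,D\xi)=0$ and $\eta(t)=\Pi\xi(t)$.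
   Context: Summation over repeated Greek indices from $1$ to $k$ is assumed. A linear Lagrangian system $(E,\Lambda)$: $E=\{E_t\}_{t\in\mathbb{R}/\tau\mathbb{Z}}$ is a smooth vector bundle (rank $m$) with a metric $(\cdot,\cdot)$, a compatible covariant derivative $D$ (so $\frac{d}{dt}(\xi,\eta)=(D\xi,\eta)+(\xi,D\eta)$, $D(f\xi)=\dot f\xi+fD\xi$), and symmetric operators $U(t):E_t\to E_t$; the Lagrangian is $\Lambda(\xi,D\xi)=\frac12(D\xi,D\xi)+\frac12(U\xi,\xi)$, and solutions satisfy $D^2\xi=U\xi$. The Poincaré map is $P:W\to W$, $W=E_0\oplus E_0$, $P(\xi(0),D\xi(0))=(\xi(\tau),D\xi(\tau))$, with invariant symplectic form $\omega(w,v)=(\zeta,D\xi)-(\xi,D\zeta)$ for $w,v\in W$ corresponding to solutions $\zeta,\xi$; isotropic means $\omega|_V=0$. $\zeta^1,\dots,\zeta^k$ is a basis of $\Gamma$, $I^\alpha(\xi,D\xi)=(\zeta^\alpha,D\xi)-(\xi,D\zeta^\alpha)$, $I=(I^1,\dots,I^k)$, $G=(g^{\alpha\beta})$, $g^{\alpha\beta}(t)=(\zeta^\alpha(t),\zeta^\beta(t))$, $(g_{\alpha\beta})=G^{-1}$. $E_t^\perp$ is the orthogonal complement of $F_t$ in $E_t$, $\Pi=\Pi_t:E_t\to E_t^\perp$ the orthogonal projection, $D^\perp\xi=\Pi D\xi$. The Routh system $(E^\perp,\Lambda^\perp)$ is the linear Lagrangian system on $E^\perp=(E_t^\perp)$ with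 covariant derivative $D^\perp$ and $$\Lambda^\perp(\eta,D^\perp\eta)=\tfrac12(D^\perp\eta,D^\perp\eta)+\tfrac12(U^\perp\eta,\eta),\qquad (U^\perp u,u)=(Uu,u)-3g_{\alpha\beta}(u,D^\perp\zeta^\alpha)(u,D^\perp\zeta^\beta),\ u\in E_t^\perp,$$ $U^\perp(t):E_t^\perp\to E_t^\perp$ symmetric. *)

(* Defs.v *)
From HB Require Import structures.
From mathcomp Require Import all_boot all_order all_algebra generic_quotient.
From mathcomp Require Import all_classical all_reals all_analysis.

Set Implicit Arguments.
Unset Strict Implicit.
Unset Printing Implicit Defensive.

Import Order.TTheory GRing.Theory Num.Theory numFieldNormedType.Exports.

Local Open Scope classical_set_scope.
Local Open Scope ring_scope.
Local Open Scope quotient_scope.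

(* C^oo on an open set A of the line; [A] is meant to be open, so the values of
   f outside A are irrelevant. *)
Definition smooth_on (R : realType) (A : set R) (f : R -> R) : Prop :=
  forall (n : nat) (t : R), A t -> derivable (derive1n n f) t 1.

Definition smooth (R : realType) (f : R -> R) : Prop := smooth_on setT f.

Section Circle.
Variables (R : realType) (tau : R).

Definition circle_rel : rel R :=
  fun s t => `[< exists n : int, s - t = n%:~R * tau >].

Lemma circle_rel_refl : reflexive circle_rel.
Proof. by move=> s; apply/asboolP; exists 0; rewrite subrr mul0r. Qed.

Lemma circle_rel_sym : symmetric circle_rel.
Proof.
move=> s t; apply/asboolP/asboolP => -[n st]; exists (- n);
  by rewrite rmorphN mulNr -st opprB.
Qed.

Lemma circle_rel_trans : transitive circle_rel.
Proof.
move=> t s u /asboolP[n st] /asboolP[p tu]; apply/asboolP; exists (n + p).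
by rewrite rmorphD mulrDl -st -tu addrA subrK.
Qed.

Canonical circle_equiv :=
  EquivRel circle_rel circle_rel_refl circle_rel_sym circle_rel_trans.

(* R / tau Z *)
Definition circle := {eq_quot circle_equiv}.

Definition to_circle (t : R) : circle := \pi_{eq_quot circle_equiv} t.

Lemma to_circle_period (t : R) : to_circle (t + tau) = to_circle t.
Proof.
by apply/eqmodP/asboolP; exists 1; rewrite mul1r addrAC subrr add0r.
Qed.

End Circle.

Arguments to_circle {R} tau t.

(* Smooth real vector bundles of rank m over R / tau Z, given by an atlas of
   local trivializations.  A subset of the circle is open when its preimage in
   R is, and a function on it is smooth when its lift to R is. *)
Record vector_bundle (R : realType) (tau : R) (m : nat) : Type := VectorBundle {
  fiber : circle tau -> vectType R;
  chart : Type;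
  chart_dom : chart -> set (circle tau);
  chart_map : forall (i : chart) (c : circle tau), 'Hom(fiber c, 'rV[R]_m);
  chart_dom_open : forall i, open (to_circle tau @^-1` chart_dom i);
  chart_cover : forall c, exists i, chart_dom i c;
  chart_bij : forall i c, chart_dom i c -> bijective (chart_map i c);
  chart_transition : forall (i j : chart) (v : 'rV[R]_m) (l : 'I_m),
    smooth_on (to_circle tau @^-1` (chart_dom i `&` chart_dom j))
      (fun t => chart_map j (to_circle tau t)
                  ((chart_map i (to_circle tau t))^-1%VF v) 0 l)
}.

Section Sections.
Variables (R : realType) (tau : R) (m : nat) (E : vector_bundle tau m).

(* E_t, for t a real number; E_(t + tau) and E_t are the same fiber, but only
   up to the propositional equality [to_circle_period]. *)
Definition fiber_at (t : R) : vectType R := fiber E (to_circle tau t).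

Definition fiber_cast (c d : circle tau) (cd : c = d) : fiber E c -> fiber E d :=
  match cd in _ = d' return fiber E c -> fiber E d' with erefl => id end.

(* Not necessarily tau-periodic sections t |-> xi(t) \in E_t, t real, i.e.
   sections of the pull-back of E to R. *)
Definition bsection : Type := forall t : R, fiber_at t.

Definition smooth_section (xi : bsection) : Prop :=
  forall (i : chart E) (l : 'I_m),
    smooth_on (to_circle tau @^-1` chart_dom i)
      (fun t => chart_map i (to_circle tau t) (xi t) 0 l).

Definition shift (xi : bsection) : bsection :=
  fun t => fiber_cast (to_circle_period tau t) (xi (t + tau)).

Definition periodic (xi : bsection) : Prop := shift xi = xi.

End Sections.

(* The covariant derivative is given through its action on the smooth sections
   along R (its values on non-smooth sections are irrelevant);
   [cov_shift] says that it comes from one on the bundle over the circle. *)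
Record lagrangian_system (R : realType) (tau : R) (m : nat) : Type :=
  LagrangianSystem {
  bundle :> vector_bundle tau m;
  metric : forall c : circle tau, fiber bundle c -> fiber bundle c -> R;
  metric_linear : forall c (a : R) (u v w : fiber bundle c),
    metric (a *: u + v) w = a * metric u w + metric v w;
  metric_sym : forall c (u v : fiber bundle c), metric u v = metric v u;
  metric_pos : forall c (u : fiber bundle c), u != 0 -> 0 < metric u u;
  metric_smooth : forall xi eta : bsection bundle,
    smooth_section xi -> smooth_section eta ->
    smooth (fun t => metric (xi t) (eta t));
  cov : bsection bundle -> bsection bundle;
  cov_smooth : forall xi, smooth_section xi -> smooth_section (cov xi);
  cov_add : forall xi eta, smooth_section xi -> smooth_section eta ->
    forall t, cov (fun s => xi s + eta s) t = cov xi t + cov eta t;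
  cov_leibniz : forall (f : R -> R) xi, smooth f -> smooth_section xi ->
    forall t, cov (fun s => f s *: xi s) t = derive1 f t *: xi t + f t *: cov xi t;
  cov_shift : forall xi, smooth_section xi -> cov (shift xi) = shift (cov xi);
  cov_metric : forall xi eta, smooth_section xi -> smooth_section eta ->
    forall t, derive1 (fun s => metric (xi s) (eta s)) t =
      metric (cov xi t) (eta t) + metric (xi t) (cov eta t);
  pot : forall c : circle tau, 'End(fiber bundle c);
  pot_sym : forall c (u v : fiber bundle c), metric (pot c u) v = metric u (pot c v);
  pot_smooth : forall xi : bsection bundle, smooth_section xi ->
    smooth_section (fun t => pot (to_circle tau t) (xi t) : fiber_at bundle t)
}.

Section System.
Variables (R : realType) (tau : R) (m : nat) (L : lagrangian_system tau m).

Notation E_ t := (fiber_at L t).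
Notation "(< u , v >)" := (metric u v) (at level 0, format "(< u ,  v >)").
Notation D := (@cov _ _ _ L).

Definition U (t : R) : 'End(E_ t) := pot L (to_circle tau t).

(* The Euler-Lagrange equation D^2 xi = U xi of
   Lambda = 1/2 (D xi, D xi) + 1/2 (U xi, xi); the coefficients being smooth,
   all its solutions are. *)
Definition solution (xi : bsection L) : Prop :=
  smooth_section xi /\ forall t, D (D xi) t = U t (xi t).

(* W = E_0 (+) E_0 *)
Definition phase : vectType R := (E_ 0 * E_ 0)%type.

(* The default value 0 of [xget] is never used: solutions exist and are
   determined by their initial data. *)
Definition poincare (w : phase) : phase :=
  xget 0 [set w' : phase | exists xi, [/\ solution xi, w = (xi 0, D xi 0)
                                    & w' = (shift xi 0, shift (D xi) 0)]].

(* The form (zeta, D xi) - (xi, D zeta) does not depend on time along two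
   solutions; it is evaluated at time 0. *)
Definition omega (w v : phase) : R := (< w.1, v.2 >) - (< v.1, w.2 >).

Definition isotropic (V : {vspace phase}) : Prop :=
  forall w v, w \in V -> v \in V -> omega w v = 0.

Section Reduction.
Variable V : {vspace phase}.

Definition Gamma : set (bsection L) :=
  [set zeta | [/\ solution zeta, periodic zeta & (zeta 0, D zeta 0) \in V]].

Definition F (t : R) : set (E_ t) := [set u | exists2 zeta, Gamma zeta & u = zeta t].

Definition Eperp (t : R) : set (E_ t) :=
  [set u | forall v, F v -> (< u, v >) = 0].

(* orthogonal projection of E_t on the orthogonal complement of F_t *)
Definition Pi (t : R) (u : E_ t) : E_ t :=
  xget 0 [set v | Eperp v /\ F (u - v)].

Definition Dperp (eta : bsection L) : bsection L := fun t => Pi (D eta t).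

Variables (k : nat) (zeta : 'I_k -> bsection L).

Definition Gamma_basis : Prop :=
  [/\ forall al, Gamma (zeta al),
      forall a : 'I_k -> R,
        (forall t, \sum_al a al *: zeta al t = 0) -> forall al, a al = 0
    & forall xi, Gamma xi ->
        exists a : 'I_k -> R, forall t, xi t = \sum_al a al *: zeta al t].

Definition noether (al : 'I_k) (xi : bsection L) (t : R) : R :=
  (< zeta al t, D xi t >) - (< xi t, D (zeta al) t >).

Definition G (t : R) : 'M[R]_k := \matrix_(al, be) (< zeta al t, zeta be t >).

(* T is a symmetric operator on the orthogonal complement of F_t with the
   quadratic form of the Routh potential; the values of T elsewhere are
   irrelevant. *)
Definition is_Uperp (t : R) (T : 'End(E_ t)) : Prop :=
  [/\ forall u, Eperp u -> Eperp (T u),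
      forall u v, Eperp u -> Eperp v -> (< T u, v >) = (< u, T v >)
    & forall u, Eperp u ->
        (< T u, u >) = (< U t u, u >) -
          3 * \sum_al \sum_be invmx (G t) al be *
                (< u, Dperp (zeta al) t >) * (< u, Dperp (zeta be) t >)].

Definition Uperp (t : R) : 'End(E_ t) := xget 0 [set T | is_Uperp T].

(* Solutions of the Routh system: sections of the orthogonal complement of F
   satisfying the Euler-Lagrange equation of
   1/2 (Dperp eta, Dperp eta) + 1/2 (Uperp eta, eta). *)
Definition routh_solution (eta : bsection L) : Prop :=
  [/\ smooth_section eta, forall t, Eperp (eta t)
    & forall t, Dperp (Dperp eta) t = Uperp t (eta t)].

End Reduction.
End System.

Arguments Pi {R tau m L} V {t} u.

(* The set A is a linear subspace of dimension k. *)
Definition has_dim (R : realType) (T : vectType R) (A : set T) (k : nat) : Prop :=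
  exists S : {vspace T}, (forall u, A u <-> u \in S) /\ \dim S = k.

(* Main.v *)
Require Import Defs.
From HB Require Import structures.
From mathcomp Require Import all_boot all_order all_algebra.
From mathcomp Require Import all_classical all_reals all_analysis.
From mathcomp Require Import ring lra.

Set Implicit Arguments.
Unset Strict Implicit.
Unset Printing Implicit Defensive.

Import Order.TTheory GRing.Theory Num.Theory numFieldNormedType.Exports.

Local Open Scope classical_set_scope.
Local Open Scope ring_scope.

(** Write mu_al = sum_be g_(al be) (eta, D zeta^be), with g the inverse of the
    Gram matrix G.  Every section is uniquely xi = eta + sum_al lam_al zeta^al
    with eta = Pi xi orthogonal to F, because dim F_t = k makes the zeta^al(t)
    linearly independent and G(t) invertible.  The proof compares xi and eta.

    - Isotropy of V and constancy of the symplectic form along solutions give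
      (zeta^al, D zeta^be) = (zeta^be, D zeta^al) at all times
      ([zeta_isotropic]).  Hence I^be(xi, D xi) is
      sum_al lam_al' g^(al be) - 2 (eta, D zeta^be), so I = 0 says exactly
      that lam_al' = 2 mu_al ([noether_lift], [noether_lift0P]).

    - Since Dperp eta = D eta + sum mu_al zeta^al, one has
      Dperp (Dperp eta) = Pi (D (D eta)) + sum mu_al Dperp zeta^al, whereas
      lam_al' = 2 mu_al gives
      Pi (D (D xi) - U xi) = Pi (D (D eta) - U eta) + 4 sum mu_al Dperp zeta^al.
      The difference, 3 sum mu_al Dperp zeta^al, is the correction term of
      the Routh potential, so Pi (D (D xi) - U xi) is the defect
      Dperp (Dperp eta) - Uperp eta ([routh_defect]).

    If xi is a solution with I = 0, the defect of eta vanishes.  Conversely,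
    given a Routh solution eta, take for lam_al any primitive of 2 mu_al; then
    D (D xi) - U xi has zero projection, and it is orthogonal to F because
    (zeta^be, D (D xi) - U xi) is the derivative of I^be ([derive1_noether]);
    so it vanishes.  The primitives are unique up to constants, which is the
    indeterminacy modulo Gamma.  No existence theorem for differential
    equations is needed, only primitives of smooth functions. *)

(** * Smooth functions on open sets of the line *)

Section SmoothFunctions.
Variable R : realType.
Implicit Types (A : set R) (f g h : R -> R) (n : nat) (t : R).

(** The derivatives of [f] up to order [n.+1] exist on [A].  Unlike [smooth_on],
    it passes from [f] to [derive1 f] structurally, which is what the inductive
    proofs of closure under products and inverses need. *)
Fixpoint derivable_upto n A f : Prop :=
  (forall t, A t -> derivable f t 1) /\
  if n is n'.+1 then derivable_upto n' A (derive1 f) else True.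

Lemma smooth_onP A f : smooth_on A f <-> forall n, derivable_upto n A f.
Proof.
split.
- move=> sf n; elim: n f sf => [|n IH] f sf /=; split => //.
  + exact: (sf 0).
  + exact: (sf 0).
  + by apply: IH => j t At; have := sf j.+1 t At; rewrite derive1Sn.
- move=> cf n; have := cf n; elim: n f {cf} => [|n IH] f [df c1f] t At.
    exact: df.
  by rewrite derive1Sn; apply: IH.
Qed.

Lemma derivable_uptoW n A f : derivable_upto n.+1 A f -> derivable_upto n A f.
Proof. by elim: n f => [|n IH] f [df c1f]; split => //; exact: IH. Qed.

Lemma derivable_upto_eq n A f g : open A -> (forall t, A t -> f t = g t) ->
  derivable_upto n A f -> derivable_upto n A g.
Proof.
move=> oA; have nearA h1 h2 t : (forall t, A t -> h1 t = h2 t) -> A t ->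
    \forall s \near t, h1 s = h2 s.
  move=> h12 At; have := open_nbhs_nbhs (conj oA At).
  by apply: filterS => s; exact: h12.
elim: n f g => [|n IH] f g fg [df c1f]; split; [|by []| |].
- move=> t At; exact: (near_eq_derivable (nearA _ _ t fg At) (df t At)).
- move=> t At; exact: (near_eq_derivable (nearA _ _ t fg At) (df t At)).
- apply: IH c1f => t At; rewrite !derive1E.
  exact: near_eq_derive (nearA _ _ t fg At).
Qed.

Lemma derivable_upto_cst n A (a : R) : derivable_upto n A (fun=> a).
Proof.
have dc (b : R) t : A t -> derivable (fun=> b) t (1 : R).
  by move=> _; exact: derivable_cst.
elim: n a => [|n IH] a; (split; first by move=> t; exact: dc); first by [].
suff -> : derive1 (fun=> a) = (fun=> 0) :> (R -> R) by exact: IH.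
by apply/funext => t; exact: derive1_cst.
Qed.

Lemma derive1D f g t : derivable f t 1 -> derivable g t 1 ->
  derive1 (fun s => f s + g s) t = derive1 f t + derive1 g t.
Proof. by move=> df dg; rewrite !derive1E (deriveD df dg). Qed.

Lemma derive1M f g t : derivable f t 1 -> derivable g t 1 ->
  derive1 (fun s => f s * g s) t = derive1 f t * g t + f t * derive1 g t.
Proof.
move=> df dg; rewrite !derive1E.
have -> : (fun s => f s * g s) = f * g by [].
by rewrite (deriveM df dg) /GRing.scale/= addrC mulrC.
Qed.

Lemma derivable_uptoD n A f g : open A ->
  derivable_upto n A f -> derivable_upto n A g ->
  derivable_upto n A (fun t => f t + g t).
Proof.
move=> oA; elim: n f g => [|n IH] f g [df c1f] [dg c1g].
all: split; first by move=> t At; exact: derivableD (df t At) (dg t At).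
  by [].
apply: derivable_upto_eq (IH _ _ c1f c1g) => [//|t At].
by rewrite (derive1D (df t At) (dg t At)).
Qed.

Lemma derivable_uptoM n A f g : open A ->
  derivable_upto n A f -> derivable_upto n A g ->
  derivable_upto n A (fun t => f t * g t).
Proof.
move=> oA; elim: n f g => [|n IH] f g.
  move=> [df _] [dg _]; split; last by [].
  by move=> t At; exact: derivableM (df t At) (dg t At).
move=> cf cg; have [cf' cg'] := (derivable_uptoW cf, derivable_uptoW cg).
case: cf cg => [df c1f] [dg c1g]; split.
  by move=> t At; exact: derivableM (df t At) (dg t At).
have cD := derivable_uptoD oA (IH _ _ c1f cg') (IH _ _ cf' c1g).
apply: derivable_upto_eq cD => [//|t At].
by rewrite (derive1M (df t At) (dg t At)).
Qed.

Lemma derivable_uptoV n A f : open A -> (forall t, A t -> f t != 0) ->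
  derivable_upto n A f -> derivable_upto n A (fun t => (f t)^-1).
Proof.
move=> oA f0; elim: n => [|n IH].
  move=> [df _]; split; last by [].
  by move=> t At; exact: derivableV (f0 t At) (df t At).
move=> cf; have cV := IH (derivable_uptoW cf); case: cf => [df c1f].
split; first by move=> t At; exact: derivableV (f0 t At) (df t At).
have cN := derivable_uptoM oA (derivable_upto_cst n A (-1)) cV.
have cM := derivable_uptoM oA cN (derivable_uptoM oA cV c1f).
apply: derivable_upto_eq cM => [//|t At].
rewrite !derive1E (deriveV (f0 t At) (df t At)).
rewrite /GRing.scale/= -exprVn expr2; ring.
Qed.

Lemma smooth_on_derivable A f t : smooth_on A f -> A t -> derivable f t 1.
Proof. by move=> sf At; exact: (sf 0). Qed.

Lemma smooth_on_eq A f g : open A -> (forall t, A t -> f t = g t) ->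
  smooth_on A f -> smooth_on A g.
Proof.
move=> oA fg /smooth_onP cf; apply/smooth_onP => n.
exact: derivable_upto_eq (cf n).
Qed.

Lemma smooth_onW A f : smooth f -> smooth_on A f.
Proof. by move=> sf n t _; exact: sf. Qed.

Lemma smooth_on_cst A (a : R) : smooth_on A (fun=> a).
Proof. by apply/smooth_onP => n; exact: derivable_upto_cst. Qed.

Lemma smooth_onD A f g : open A -> smooth_on A f -> smooth_on A g ->
  smooth_on A (fun t => f t + g t).
Proof.
move=> oA /smooth_onP cf /smooth_onP cg; apply/smooth_onP => n.
exact: derivable_uptoD.
Qed.

Lemma smooth_onM A f g : open A -> smooth_on A f -> smooth_on A g ->
  smooth_on A (fun t => f t * g t).
Proof.
move=> oA /smooth_onP cf /smooth_onP cg; apply/smooth_onP => n.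
exact: derivable_uptoM.
Qed.

Lemma smooth_onV A f : open A -> (forall t, A t -> f t != 0) ->
  smooth_on A f -> smooth_on A (fun t => (f t)^-1).
Proof.
move=> oA f0 /smooth_onP cf; apply/smooth_onP => n; exact: derivable_uptoV.
Qed.

Lemma smooth_on_sum A (I : Type) (r : seq I) (P : pred I) (h : I -> R -> R) :
  open A -> (forall i, smooth_on A (h i)) ->
  smooth_on A (fun t => \sum_(i <- r | P i) h i t).
Proof.
move=> oA sh; elim: r => [|i r IH].
  by under eq_fun do rewrite big_nil; exact: smooth_on_cst.
under eq_fun do rewrite big_cons; case: (P i); last exact: IH.
exact: (smooth_onD oA (sh i) IH).
Qed.

Lemma smooth_on_prod A (I : Type) (r : seq I) (P : pred I) (h : I -> R -> R) :
  open A -> (forall i, smooth_on A (h i)) ->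
  smooth_on A (fun t => \prod_(i <- r | P i) h i t).
Proof.
move=> oA sh; elim: r => [|i r IH].
  by under eq_fun do rewrite big_nil; exact: smooth_on_cst.
under eq_fun do rewrite big_cons; case: (P i); last exact: IH.
exact: (smooth_onM oA (sh i) IH).
Qed.

Lemma smooth_on_det A p (M : R -> 'M[R]_p) : open A ->
  (forall i j, smooth_on A (fun t => M t i j)) ->
  smooth_on A (fun t => \det (M t)).
Proof.
move=> oA sM; apply: smooth_on_sum => // s.
by apply: smooth_onM => //; [exact: smooth_on_cst|exact: smooth_on_prod].
Qed.

Lemma smooth_on_invmx A p (M : R -> 'M[R]_p) : open A ->
  (forall t, A t -> M t \in unitmx) ->
  (forall i j, smooth_on A (fun t => M t i j)) ->
  forall i j, smooth_on A (fun t => invmx (M t) i j).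
Proof.
move=> oA uM sM i j.
apply: (@smooth_on_eq A (fun t => (\det (M t))^-1 * \adj (M t) i j)) => //.
  by move=> t At; rewrite /invmx uM// [RHS]mxE.
apply: smooth_onM => //.
  apply: smooth_onV => //; last exact: smooth_on_det.
  by move=> t At; rewrite -unitfE; exact: uM.
under eq_fun do rewrite mxE; apply: smooth_onM => //; first exact: smooth_on_cst.
apply: smooth_on_det => // a b; under eq_fun do rewrite !mxE; exact: sM.
Qed.

Lemma derive1_eq0_cst f : (forall t, derivable f t 1) ->
  (forall t, derive1 f t = 0) -> forall s t, f s = f t.
Proof.
move=> df f0 s t; apply: is_derive_0_is_cst => x.
exact: (DeriveDef (df x) (etrans (esym (derive1E f x)) (f0 x))).
Qed.

(** A continuous function on the line has a primitive on the whole line. *)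
Lemma continuous_primitive h : continuous h ->
  exists2 f, forall t, derivable f t 1 & derive1 f = h.
Proof.
move=> ch; pose J a b := (\int[lebesgue_measure]_(x in `[a, b]) h x)%R.
(* N t lies to the left of both 0 and t, so only integrals over segments with
   ordered endpoints occur; by additivity any such base point gives the same
   value *)
pose N t : R := - (`|t| + 1).
pose f t := J (N t) t - J (N t) 0.
have hint a b : lebesgue_measure.-integrable `[a, b] (EFin \o h).
  apply: continuous_compact_integrable; first exact: segment_compact.
  exact: continuous_subspaceT.
have JJ b c s : b <= c -> c <= s -> J b s = J b c + J c s.
  move=> bc cs.
  have := @Rintegral_itvB _ h (BLeft b) (BRight s) c (hint b s).
  rewrite !bnd_simp => /(_ bc cs); rewrite Rintegral_itv_obnd_cbnd.
    by rewrite /J => <-; rewrite addrC subrK.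
  apply: integrableS (hint c s) => //.
  exact: subset_itv_oc_cc.
have fE a t : a < 0 -> a < t -> f t = J a t - J a 0.
  move=> a0 at_; rewrite /f.
  have N0 : N t < 0 by rewrite /N; have := normr_ge0 t; lra.
  have Nt : N t < t by rewrite /N; have := ler_norm (- t); rewrite normrN; lra.
  have [aN|/ltW Na] := leP a (N t).
    rewrite (JJ a (N t) t aN (ltW Nt)) (JJ a (N t) 0 aN (ltW N0)); ring.
  by rewrite (JJ (N t) a t Na (ltW at_)) (JJ (N t) a 0 Na (ltW a0)); ring.
have fD t : derivable f t 1 /\ derive1 f t = h t.
  have N0 : N t < 0 by rewrite /N; have := normr_ge0 t; lra.
  have Nt : N t < t by rewrite /N; have := ler_norm (- t); rewrite normrN; lra.
  have t1 : t < t + 1 by rewrite ltrDl.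
  have [dJ J'] := @continuous_FTC1_closed _ h (N t) t (t + 1)
    t1 (hint _ _) Nt (ch t).
  have J0 : derivable (fun=> - J (N t) 0) t (1 : R) by exact: derivable_cst.
  have nearE : \forall s \near t, J (N t) s + - J (N t) 0 = f s.
    by near=> s; rewrite -fE//; near: s; exact: lt_nbhsr.
  have dJ0 := derivableD dJ J0.
  split; first exact: near_eq_derivable nearE dJ0.
  rewrite derive1E -(near_eq_derive _ nearE) -derive1E (derive1D dJ J0) J'.
  by rewrite derive1_cst addr0.
exists f => [t|]; first exact: (fD t).1.
by apply/funext => t; exact: (fD t).2.
Unshelve. all: by end_near.
Qed.

Lemma smooth_primitive h : smooth h -> exists2 f, smooth f & derive1 f = h.
Proof.
move=> sh; have [t|f df f'E] := @continuous_primitive h.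
  apply: differentiable_continuous; apply/derivable1_diffP.
  exact: smooth_on_derivable sh I.
exists f; [apply/smooth_onP => n | by []].
case: n => [|n]; (split; first by move=> t _; exact: df); first by [].
by rewrite f'E; move/smooth_onP: sh; apply.
Qed.

End SmoothFunctions.

(** * The metric, smooth sections and the covariant derivative *)

Section Bundle.
Variables (R : realType) (tau : R) (m : nat) (L : lagrangian_system tau m).

Notation "(< u , v >)" := (metric u v) (at level 0, format "(< u ,  v >)").
Notation D := (@cov _ _ _ L).

Section Metric.
Variable t : R.
Implicit Types (u v w : fiber_at L t) (a : R).

Lemma metricC u v : (< u, v >) = (< v, u >).
Proof. exact: Defs.metric_sym. Qed.

Lemma metricDl u v w : (< u + v, w >) = (< u, w >) + (< v, w >).
Proof. by rewrite -[u in LHS]scale1r metric_linear mul1r. Qed.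

Lemma metric0l w : (< (0 : fiber_at L t), w >) = 0.
Proof. by apply: (addrI (< 0, w >)); rewrite -metricDl !addr0. Qed.

Lemma metricZl a u w : (< a *: u, w >) = a * (< u, w >).
Proof. by rewrite -[a *: u]addr0 metric_linear metric0l addr0. Qed.

Lemma metricBl u v w : (< u - v, w >) = (< u, w >) - (< v, w >).
Proof. by rewrite metricDl -scaleN1r metricZl mulN1r. Qed.

Lemma metric_suml (I : Type) (r : seq I) (h : I -> fiber_at L t) w :
  (< \sum_(i <- r) h i, w >) = \sum_(i <- r) (< h i, w >).
Proof.
elim: r => [|i r IH]; first by rewrite !big_nil metric0l.
by rewrite !big_cons metricDl IH.
Qed.

Lemma metricDr u v w : (< w, u + v >) = (< w, u >) + (< w, v >).
Proof. by rewrite metricC metricDl !(metricC w). Qed.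

Lemma metricZr a u w : (< w, a *: u >) = a * (< w, u >).
Proof. by rewrite metricC metricZl (metricC w). Qed.

Lemma metricBr u v w : (< w, u - v >) = (< w, u >) - (< w, v >).
Proof. by rewrite metricC metricBl !(metricC w). Qed.

Lemma metric_sumr (I : Type) (r : seq I) (h : I -> fiber_at L t) w :
  (< w, \sum_(i <- r) h i >) = \sum_(i <- r) (< w, h i >).
Proof.
by rewrite metricC metric_suml; apply: eq_bigr => i _; rewrite metricC.
Qed.

Lemma metric_eq0 u : (< u, u >) = 0 -> u = 0.
Proof.
by move=> uu; apply/eqP; apply: contraT => /metric_pos; rewrite uu ltxx.
Qed.

End Metric.

Lemma section_eq (xi eta : bsection L) : (forall t, xi t = eta t) -> xi = eta.
Proof. exact: functional_extensionality_dep. Qed.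

Lemma smooth_section_add (xi eta : bsection L) :
  smooth_section xi -> smooth_section eta ->
  smooth_section (fun t => xi t + eta t : fiber_at L t).
Proof.
move=> sx se i l; under eq_fun do rewrite linearD mxE.
apply: smooth_onD; [exact: chart_dom_open|exact: sx|exact: se].
Qed.

Lemma smooth_section_scale (f : R -> R) (xi : bsection L) :
  smooth f -> smooth_section xi ->
  smooth_section (fun t => f t *: xi t : fiber_at L t).
Proof.
move=> sf sx i l; under eq_fun do rewrite linearZ mxE.
apply: smooth_onM; [exact: chart_dom_open|exact: smooth_onW|exact: sx].
Qed.

Lemma smooth_section_zero : smooth_section (fun t => 0 : fiber_at L t).
Proof.
by move=> i l; under eq_fun do rewrite linear0 mxE; exact: smooth_on_cst.
Qed.

Lemma smooth_section_sum (I : Type) (r : seq I) (f : I -> R -> R)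
    (xi : I -> bsection L) :
  (forall i, smooth (f i)) -> (forall i, smooth_section (xi i)) ->
  smooth_section (fun t => \sum_(i <- r) f i t *: xi i t : fiber_at L t).
Proof.
move=> sf sx; elim: r => [|i r IH].
  rewrite [X in smooth_section X](_ : _ = fun t => 0 : fiber_at L t).
    exact: smooth_section_zero.
  by apply: section_eq => t; rewrite big_nil.
rewrite [X in smooth_section X](_ : _ = fun t => f i t *: xi i t +
    \sum_(j <- r) f j t *: xi j t : fiber_at L t).
  by apply: smooth_section_add IH; exact: smooth_section_scale.
by apply: section_eq => t; rewrite big_cons.
Qed.

Lemma cov0 t : D (fun s => 0 : fiber_at L s) t = 0.
Proof.
have := cov_leibniz (@smooth_on_cst R setT 0) smooth_section_zero t.
rewrite derive1_cst !scale0r addr0 => <-; congr (D _ t).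
by apply: section_eq => s; rewrite scaler0.
Qed.

Lemma cov_sum (I : Type) (r : seq I) (f : I -> R -> R) (xi : I -> bsection L) t :
  (forall i, smooth (f i)) -> (forall i, smooth_section (xi i)) ->
  D (fun s => \sum_(i <- r) f i s *: xi i s) t =
  \sum_(i <- r) (derive1 (f i) t *: xi i t + f i t *: D (xi i) t).
Proof.
move=> sf sx; elim: r => [|i r IH].
  rewrite big_nil -[RHS](cov0 t); congr (D _ t).
  by apply: section_eq => s; rewrite big_nil.
rewrite big_cons -IH -(cov_leibniz (sf i) (sx i)) -cov_add.
- by congr (D _ t); apply: section_eq => s; rewrite big_cons.
- exact: smooth_section_scale.
- exact: smooth_section_sum.
Qed.

(** The covariant derivative commutes with constant linear combinations. *)
Lemma cov_comb (I : Type) (r : seq I) (a : I -> R) (xi : I -> bsection L) :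
  (forall i, smooth_section (xi i)) ->
  D (fun s => \sum_(i <- r) a i *: xi i s) =
  (fun t => \sum_(i <- r) a i *: D (xi i) t).
Proof.
move=> sx; apply: section_eq => t.
rewrite (@cov_sum _ r (fun i _ => a i))//; last first.
  by move=> i; exact: (@smooth_on_cst R setT).
by apply: eq_bigr => i _; rewrite derive1_cst scale0r add0r.
Qed.

Lemma sum_phase (I : Type) (r : seq I) (a : I -> R) (x y : I -> fiber_at L 0) :
  \sum_(i <- r) a i *: ((x i, y i) : phase L) =
  (\sum_(i <- r) a i *: x i, \sum_(i <- r) a i *: y i).
Proof.
elim: r => [|i r IH]; first by rewrite !big_nil.
by rewrite !big_cons IH.
Qed.

Lemma derive1_metric (xi eta : bsection L) t :
  smooth_section xi -> smooth_section eta ->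
  derive1 (fun s => (< xi s, eta s >)) t = (< D xi t, eta t >) + (< xi t, D eta t >).
Proof. by move=> sx se; exact: cov_metric. Qed.

Lemma derivable_metric (xi eta : bsection L) t :
  smooth_section xi -> smooth_section eta ->
  derivable (fun s => (< xi s, eta s >)) t 1.
Proof. by move=> sx se; exact: (smooth_on_derivable (metric_smooth sx se)). Qed.

Lemma fiber_cast_sum (c d : circle tau) (cd : c = d) (I : Type) (r : seq I)
    (a : I -> R) (h : I -> fiber L c) :
  fiber_cast cd (\sum_(i <- r) a i *: h i) =
  \sum_(i <- r) a i *: fiber_cast cd (h i).
Proof. by case: d / cd. Qed.

End Bundle.

(** * Orthogonal projection along the periodic solutions *)

Section Reduction.
Variables (R : realType) (tau : R) (m k : nat) (L : lagrangian_system tau m).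
Variables (V : {vspace phase L}) (zeta : 'I_k -> bsection L).
Hypothesis V_iso : isotropic V.
Hypothesis F_dim : forall t : R, has_dim (@F R tau m L V t) k.
Hypothesis zeta_basis : Gamma_basis V zeta.

Notation "(< u , v >)" := (metric u v) (at level 0, format "(< u ,  v >)").
Notation D := (@cov _ _ _ L).
Notation E_ t := (fiber_at L t).

Lemma zeta_Gamma al : Gamma V (zeta al).
Proof. by case: zeta_basis. Qed.

Lemma zeta_smooth al : smooth_section (zeta al).
Proof. by case: (zeta_Gamma al) => -[]. Qed.

Lemma cov_zeta_smooth al : smooth_section (D (zeta al)).
Proof. exact: cov_smooth (@zeta_smooth al). Qed.

Lemma zeta_solution al t : D (D (zeta al)) t = U L t (zeta al t).
Proof. by case: (zeta_Gamma al) => -[]. Qed.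

(** [Gamma V] is a linear space. *)
Lemma comb_Gamma (a : 'I_k -> R) : Gamma V (fun t => \sum_al a al *: zeta al t).
Proof.
have sm : smooth_section (fun t => \sum_al a al *: zeta al t : E_ t).
  apply: (@smooth_section_sum _ _ _ L _ _ (fun al _ => a al)).
    by move=> al; exact: (@smooth_on_cst R setT).
  exact: zeta_smooth.
split; first split => // t.
- rewrite (@cov_comb _ _ _ L _ _ a zeta (@zeta_smooth)).
  rewrite (@cov_comb _ _ _ L _ _ a _ (@cov_zeta_smooth)).
  rewrite linear_sum; apply: eq_bigr => al _.
  by rewrite linearZ/= zeta_solution.
- apply: section_eq => t.
  apply: (etrans (fiber_cast_sum _ _ a (fun al => zeta al (t + tau)))).
  apply: eq_bigr => al _; congr (_ *: _).
  by case: (zeta_Gamma al) => _ /(congr1 (fun xi : bsection L => xi t)).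
- rewrite (@cov_comb _ _ _ L _ _ a zeta (@zeta_smooth)).
  rewrite -sum_phase; apply: memv_suml => al _; apply: memvZ.
  by case: (zeta_Gamma al).
Qed.

Lemma F_spanP t (u : E_ t) :
  F V u <-> exists a : 'I_k -> R, u = \sum_al a al *: zeta al t.
Proof.
split=> [[xi Gxi ->]|[a ->]].
  by case: zeta_basis => _ _ /(_ xi Gxi)[a xiE]; exists a.
by exists (fun s => \sum_al a al *: zeta al s); first exact: comb_Gamma.
Qed.

Lemma zeta_in_F al t : F V (zeta al t).
Proof. by exists (zeta al) => //; exact: zeta_Gamma. Qed.

Lemma F_linear t (a : R) (u v : E_ t) : F V u -> F V v -> F V (a *: u + v).
Proof.
move=> /F_spanP[b ->] /F_spanP[c ->]; apply/F_spanP.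
exists (fun al => a * b al + c al); rewrite scaler_sumr -big_split/=.
by apply: eq_bigr => al _; rewrite scalerA scalerDl.
Qed.

Lemma F_sub t (u v : E_ t) : F V u -> F V v -> F V (u - v).
Proof. by move=> Fu Fv; rewrite addrC -scaleN1r; exact: F_linear. Qed.

Lemma F_comb t (a : 'I_k -> R) : F V (\sum_al a al *: zeta al t).
Proof. by apply/F_spanP; exists a. Qed.

(** The [zeta al t] span a space of dimension [k], hence are independent. *)
Lemma zeta_free t (a : 'I_k -> R) :
  \sum_al a al *: zeta al t = 0 -> forall al, a al = 0.
Proof.
have [S [FS dimS]] := F_dim t.
pose X : k.-tuple (E_ t) := [tuple zeta al t | al < k].
have SX : (S <= <<X>>)%VS.
  apply/subvP => u /FS/F_spanP[b ->]; apply: memv_suml => al _.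
  apply: memvZ; apply: memv_span; apply/tnthP.
  by exists al; rewrite tnth_mktuple.
have freeX : free X.
  by rewrite /free eqn_leq dim_span size_tuple -[X in (X <= _)%N]dimS dimvS.
move/freeP: freeX => fX a0 al; apply: fX al.
by rewrite -[RHS]a0; apply: eq_bigr => be _; rewrite -tnth_nth tnth_mktuple.
Qed.

Lemma G_sym t : (G zeta t)^T = G zeta t.
Proof. by apply/matrixP => al be; rewrite !mxE metricC. Qed.

Lemma G_unit t : G zeta t \in unitmx.
Proof.
rewrite unitmxE unitfE; apply/det0P => -[v v0 vG].
(* a kernel vector of the Gram matrix is a combination of norm zero *)
suff uu : \sum_al v 0 al *: zeta al t = 0.
  by move/eqP: v0; apply; apply/rowP => al; rewrite mxE (zeta_free uu).
apply: metric_eq0; rewrite metric_sumr big1// => be _; rewrite metricZr.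
move/rowP/(_ be): vG; rewrite !mxE metric_suml => vG.
rewrite [X in _ * X](_ : _ = 0) ?mulr0// -[RHS]vG; apply: eq_bigr => al _.
by rewrite metricZl mxE.
Qed.

(** The vector g_(al be) w^be, the solution of the linear system with matrix
    [G zeta t] and right-hand side [w]. *)
Definition gram_sol t (w : 'I_k -> R) (al : 'I_k) : R :=
  \sum_be invmx (G zeta t) al be * w be.

Lemma gram_solP t (c w : 'I_k -> R) :
  (forall be, \sum_al c al * (< zeta al t, zeta be t >) = w be) <->
  (forall al, c al = gram_sol t w al).
Proof.
pose cc : 'cV[R]_k := \col_al c al; pose ww : 'cV[R]_k := \col_be w be.
have -> : (forall be, \sum_al c al * (< zeta al t, zeta be t >) = w be) <->
    G zeta t *m cc = ww.
  split=> [h|h be].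
    apply/colP => be; rewrite !mxE -h; apply: eq_bigr => al _.
    by rewrite !mxE mulrC metricC.
  move/colP/(_ be): h; rewrite !mxE => <-; apply: eq_bigr => al _.
  by rewrite !mxE mulrC metricC.
have -> : (forall al, c al = gram_sol t w al) <-> cc = invmx (G zeta t) *m ww.
  split=> [h|h al].
    apply/colP => al; rewrite !mxE h; apply: eq_bigr => be _.
    by rewrite !mxE.
  move/colP/(_ al): h; rewrite !mxE => ->; apply: eq_bigr => be _.
  by rewrite !mxE.
by split=> [<-|->]; rewrite ?mulKmx ?mulKVmx ?G_unit.
Qed.

(** The coordinates, with respect to the [zeta al t], of the component of [u]
    in [F V]. *)
Definition coef t (u : E_ t) (al : 'I_k) : R :=
  gram_sol t (fun be => (< u, zeta be t >)) al.

Lemma EperpP t (u : E_ t) :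
  Eperp V u <-> forall al, (< u, zeta al t >) = 0.
Proof.
split=> [pu al|pu v /F_spanP[a ->]]; first exact: pu (zeta_in_F al t).
by rewrite metric_sumr big1// => al _; rewrite metricZr pu mulr0.
Qed.

Lemma Eperp_linear t (a : R) (u v : E_ t) :
  Eperp V u -> Eperp V v -> Eperp V (a *: u + v).
Proof.
by move=> pu pv w Fw; rewrite metricDl metricZl pu// pv// mulr0 addr0.
Qed.

Lemma Eperp_sub t (u v : E_ t) : Eperp V u -> Eperp V v -> Eperp V (u - v).
Proof. by move=> pu pv; rewrite addrC -scaleN1r; exact: Eperp_linear. Qed.

Lemma Eperp_F0 t (u : E_ t) : Eperp V u -> F V u -> u = 0.
Proof. by move=> pu Fu; apply: metric_eq0; exact: pu. Qed.

(** The two conditions defining the orthogonal projection determine it. *)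
Lemma Pi_unique t (u v : E_ t) : Eperp V v -> F V (u - v) -> Pi V u = v.
Proof.
move=> pv Fuv; apply: xget_subset1 => // v1 v2 [p1 F1] [p2 F2].
apply/eqP; rewrite -subr_eq0; apply/eqP/Eperp_F0; first exact: Eperp_sub.
rewrite -[v1 - v2](_ : (u - v2) - (u - v1) = _); first exact: F_sub.
by rewrite opprB addrC subrKA.
Qed.

Lemma Pi_perp_sub t (u : E_ t) :
  Eperp V (u - \sum_al coef u al *: zeta al t).
Proof.
apply/EperpP => be; rewrite metricBl metric_suml.
have [_ /(_ (fun=> erefl)) <-] :=
  gram_solP t (coef u) (fun be => (< u, zeta be t >)).
by apply/eqP; rewrite subr_eq0; apply/eqP/eq_bigr => al _; rewrite metricZl.
Qed.

Lemma PiE t (u : E_ t) : Pi V u = u - \sum_al coef u al *: zeta al t.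
Proof.
apply: Pi_unique; first exact: Pi_perp_sub.
by rewrite subKr; exact: F_comb.
Qed.

Lemma Pi_perp t (u : E_ t) : Eperp V (Pi V u).
Proof. by rewrite PiE; exact: Pi_perp_sub. Qed.

Lemma Pi_F t (u : E_ t) : F V (u - Pi V u).
Proof. by rewrite PiE subKr; exact: F_comb. Qed.

Lemma Pi_id t (u : E_ t) : Eperp V u -> Pi V u = u.
Proof.
move=> pu; apply: Pi_unique => //; rewrite subrr -[0](subrr (u - Pi V u)).
by apply: F_sub; exact: Pi_F.
Qed.

Lemma Pi_linear t (a : R) (u v : E_ t) :
  Pi V (a *: u + v) = a *: Pi V u + Pi V v.
Proof.
apply: Pi_unique; first by apply: Eperp_linear; exact: Pi_perp.
rewrite opprD addrACA -scalerBr; apply: F_linear; exact: Pi_F.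
Qed.

Lemma Pi_F0 t (u : E_ t) : F V u -> Pi V u = 0.
Proof.
move=> Fu; apply: Pi_unique; last by rewrite subr0.
by move=> v _; rewrite metric0l.
Qed.

Lemma Pi0 t : Pi V (0 : E_ t) = 0.
Proof. by apply: Pi_id => v _; rewrite metric0l. Qed.

Lemma PiD t (u v : E_ t) : Pi V (u + v) = Pi V u + Pi V v.
Proof. by rewrite -[u in LHS]scale1r Pi_linear scale1r. Qed.

Lemma PiZ t (a : R) (u : E_ t) : Pi V (a *: u) = a *: Pi V u.
Proof. by rewrite -[a *: u]addr0 Pi_linear Pi0 addr0. Qed.

Lemma Pi_comb t (a : 'I_k -> R) (u : 'I_k -> E_ t) :
  Pi V (\sum_al a al *: u al) = \sum_al a al *: Pi V (u al).
Proof.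
rewrite (big_morph (Pi V) (@PiD t) (Pi0 t)).
by apply: eq_bigr => al _; rewrite PiZ.
Qed.

Lemma metric_Pi t (u v : E_ t) : Eperp V v -> (< Pi V u, v >) = (< u, v >).
Proof.
move=> pv; apply/esym/eqP; rewrite -subr_eq0 -metricBl metricC.
by apply/eqP/pv; exact: Pi_F.
Qed.

Lemma gram_sol_smooth (w : 'I_k -> R -> R) al : (forall be, smooth (w be)) ->
  smooth (fun t => gram_sol t (fun be => w be t) al).
Proof.
move=> sw; apply: smooth_on_sum => [|be]; first exact: openT.
apply: smooth_onM; [exact: openT| |exact: sw].
apply: smooth_on_invmx; [exact: openT|by move=> t _; exact: G_unit|] => i j.
rewrite (_ : (fun t => G zeta t i j) = (fun t => (< zeta i t, zeta j t >))).
  by apply: metric_smooth; exact: zeta_smooth.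
by apply/funext => t; rewrite mxE.
Qed.

Lemma coef_smooth (xi : bsection L) al :
  smooth_section xi -> smooth (fun t => coef (xi t) al).
Proof.
move=> sx; apply: gram_sol_smooth => be.
by apply: metric_smooth; [exact: sx|exact: zeta_smooth].
Qed.

Lemma Pi_smooth (xi : bsection L) : smooth_section xi ->
  smooth_section (fun t => Pi V (xi t)).
Proof.
move=> sx; rewrite [X in smooth_section X](_ : _ = (fun t =>
    xi t + \sum_al (-1 * coef (xi t) al) *: zeta al t : E_ t)); last first.
  apply: section_eq => t; rewrite PiE -sumrN; congr (_ + _).
  by apply: eq_bigr => al _; rewrite mulN1r scaleNr.
apply: smooth_section_add; first exact: sx.
apply: smooth_section_sum; last exact: zeta_smooth.
move=> al; apply: smooth_onM; [exact: openT|exact: smooth_on_cst|].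
exact: coef_smooth.
Qed.

(** * The Routh potential *)

(** The functions mu_al = g_(al be) (u, D zeta^be). *)
Definition dcoef t (u : E_ t) (al : 'I_k) : R :=
  gram_sol t (fun be => (< u, D (zeta be) t >)) al.

(** An explicit operator on the whole fiber whose restriction to the orthogonal
    complement is the Routh potential. *)
Definition routh_op t (u : E_ t) : E_ t :=
  Pi V (U L t u) - 3 *: \sum_al dcoef u al *: Dperp V (zeta al) t.

Lemma gram_sol_linear t (a : R) (w w' : 'I_k -> R) al :
  gram_sol t (fun be => a * w be + w' be) al =
  a * gram_sol t w al + gram_sol t w' al.
Proof.
rewrite /gram_sol mulr_sumr -big_split/=; apply: eq_bigr => be _; ring.
Qed.

Lemma eq_gram_sol t (w w' : 'I_k -> R) al :
  (forall be, w be = w' be) -> gram_sol t w al = gram_sol t w' al.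
Proof. by move=> ww'; apply: eq_bigr => be _; rewrite ww'. Qed.

Lemma routh_op_linear t : linear (@routh_op t).
Proof.
move=> a u v; rewrite /routh_op linearP Pi_linear scalerBr addrACA -opprD.
congr (_ - _); rewrite [a *: (3 *: _)]scalerA [a * 3]mulrC -scalerA -scalerDr.
congr (3 *: _); rewrite scaler_sumr -big_split/=; apply: eq_bigr => al _.
rewrite scalerA -scalerDl; congr (_ *: _); rewrite -gram_sol_linear.
by apply: eq_gram_sol => be; rewrite metricDl metricZl.
Qed.

Lemma metric_Dperp t (u : E_ t) al : Eperp V u ->
  (< u, Dperp V (zeta al) t >) = (< u, D (zeta al) t >).
Proof. by move=> pu; rewrite metricC metric_Pi// metricC. Qed.

Lemma metric_routh_op t (u v : E_ t) : Eperp V u -> Eperp V v ->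
  (< routh_op u, v >) = (< U L t u, v >) -
    3 * \sum_al \sum_be invmx (G zeta t) al be *
      (< u, D (zeta be) t >) * (< v, D (zeta al) t >).
Proof.
move=> pu pv; rewrite metricBl metric_Pi// metricZl metric_suml.
congr (_ - 3 * _); apply: eq_bigr => al _.
rewrite metricZl metricC metric_Dperp// mulr_suml.
by apply: eq_bigr => be _.
Qed.

Lemma invG_sym t al be : invmx (G zeta t) al be = invmx (G zeta t) be al.
Proof. by rewrite -[in RHS](G_sym t) -trmx_inv mxE. Qed.

Lemma is_Uperp_routh_op t (T : 'End(E_ t)) :
  (forall u, T u = routh_op u) -> is_Uperp V zeta T.
Proof.
move=> TE; split=> [u pu v Fv|u v pu pv|u pu]; rewrite !TE.
- rewrite metricBl metricZl metric_suml Pi_perp// big1 ?mulr0 ?subr0// => al _.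
  by rewrite metricZl Pi_perp// mulr0.
- rewrite metric_routh_op// [RHS]metricC metric_routh_op//; congr (_ - 3 * _).
    by rewrite /U Defs.pot_sym metricC.
  rewrite exchange_big; apply: eq_bigr => al _; apply: eq_bigr => be _.
  by rewrite invG_sym -!mulrA [X in _ * X]mulrC.
- rewrite metric_routh_op//; congr (_ - 3 * _).
  apply: eq_bigr => al _; apply: eq_bigr => be _.
  by rewrite !metric_Dperp// -!mulrA [X in _ * X]mulrC.
Qed.

Lemma routh_op_hom t : exists T : 'End(E_ t), forall u, T u = routh_op u.
Proof.
pose f : {linear E_ t -> E_ t} := HB.pack (@routh_op t)
  (GRing.isLinear.Build R (E_ t) (E_ t) *:%R _ (@routh_op_linear t)).
by exists (linfun f) => u; rewrite lfunE.
Qed.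

Lemma is_Uperp_polar t (T : 'End(E_ t)) (u v : E_ t) :
  is_Uperp V zeta T -> Eperp V u -> Eperp V v ->
  2 * (< T u, v >) =
  (< T (u + v), u + v >) - (< T u, u >) - (< T v, v >).
Proof.
case=> _ symT _ pu pv; rewrite linearD !metricDl !metricDr.
rewrite [(< T v, u >)]symT// [(< v, T u >)]metricC; ring.
Qed.

(** By polarization the Routh potential is determined on the orthogonal
    complement, though not elsewhere. *)
Lemma is_Uperp_unique t (T T' : 'End(E_ t)) (u : E_ t) :
  is_Uperp V zeta T -> is_Uperp V zeta T' -> Eperp V u -> T u = T' u.
Proof.
move=> UT UT' pu; apply/eqP; rewrite -subr_eq0; apply/eqP/metric_eq0.
have [pT _ qT] := UT; have [pT' _ qT'] := UT'.
have TT' v : Eperp V v -> (< T u, v >) = (< T' u, v >).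
  move=> pv; have puv : Eperp V (u + v).
    by rewrite -[u]scale1r; exact: Eperp_linear.
  apply: (@mulfI _ 2); first by rewrite pnatr_eq0.
  by rewrite !is_Uperp_polar// !qT// !qT'.
rewrite metricBl TT' ?subrr//; apply: Eperp_sub; [exact: pT|exact: pT'].
Qed.

Lemma UperpE t (u : E_ t) : Eperp V u -> Uperp V zeta t u = routh_op u.
Proof.
move=> pu; have [T TE] := routh_op_hom t.
rewrite -TE; apply: is_Uperp_unique pu; last exact: is_Uperp_routh_op.
apply: (@xgetPex _ 0 [set T | is_Uperp V zeta T]).
by exists T; exact: is_Uperp_routh_op.
Qed.

(** * Lifting sections of the orthogonal complement *)

Lemma derivable_metric_cov (xi eta : bsection L) t :
  smooth_section xi -> smooth_section eta ->
  derivable (fun s => (< xi s, D eta s >)) t 1.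
Proof.
by move=> sx se; apply: derivable_metric; [exact: sx|exact: cov_smooth se].
Qed.

(** The derivative of the symplectic form along two arbitrary sections. *)
Lemma derive1_wronskian (xi eta : bsection L) t :
  smooth_section xi -> smooth_section eta ->
  derive1 (fun s => (< xi s, D eta s >) - (< eta s, D xi s >)) t =
  (< xi t, D (D eta) t >) - (< eta t, D (D xi) t >).
Proof.
move=> sx se; have [sDx sDe] := (cov_smooth sx, cov_smooth se).
have d1 := @derivable_metric_cov xi eta t sx se.
have d2 := @derivable_metric_cov eta xi t se sx.
rewrite derive1E (deriveB d1 d2) -!derive1E.
rewrite (@derive1_metric _ _ _ L xi (D eta) t sx sDe).
rewrite (@derive1_metric _ _ _ L eta (D xi) t se sDx).
rewrite [(< D eta t, D xi t >)]metricC; ring.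
Qed.

(** The symplectic form vanishes on [Gamma V] at time 0 by hypothesis, hence at
    all times since it is constant along solutions. *)
Lemma zeta_isotropic al be t :
  (< zeta al t, D (zeta be) t >) = (< zeta be t, D (zeta al) t >).
Proof.
pose w s := (< zeta al s, D (zeta be) s >) - (< zeta be s, D (zeta al) s >).
have w0 : w 0 = 0.
  have [_ _ Va] := zeta_Gamma al; have [_ _ Vb] := zeta_Gamma be.
  exact: V_iso Va Vb.
suff : w t = 0 by move/eqP; rewrite subr_eq0 => /eqP.
rewrite -w0; apply: derive1_eq0_cst => s.
  by apply: derivableB; apply: derivable_metric_cov; exact: zeta_smooth.
rewrite /w derive1_wronskian; [|exact: zeta_smooth|exact: zeta_smooth].
rewrite !zeta_solution [X in _ - X]metricC /U Defs.pot_sym; exact: subrr.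
Qed.

(** The Euler-Lagrange defect of [xi] in the direction [zeta al] is the
    derivative of the Noether integral. *)
Lemma derive1_noether (xi : bsection L) al t : smooth_section xi ->
  derive1 (noether zeta al xi) t = (< zeta al t, D (D xi) t - U L t (xi t) >).
Proof.
move=> sx; rewrite /noether.
rewrite (@derive1_wronskian (zeta al) xi t (@zeta_smooth al) sx).
rewrite zeta_solution metricBr; congr (_ - _).
by rewrite metricC /U Defs.pot_sym.
Qed.

Section Lift.
Variables (eta : bsection L) (lam : 'I_k -> R -> R).
Hypothesis eta_smooth : smooth_section eta.
Hypothesis eta_perp : forall t, Eperp V (eta t).
Hypothesis lam_smooth : forall al, smooth (lam al).

(** The section with orthogonal component [eta] and coordinates [lam] along
    the [zeta al]. *)
Definition lift : bsection L := fun t => eta t + \sum_al lam al t *: zeta al t.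

Lemma comb_smooth (f : 'I_k -> R -> R) (xi : 'I_k -> bsection L) :
  (forall al, smooth (f al)) -> (forall al, smooth_section (xi al)) ->
  smooth_section (fun t => \sum_al f al t *: xi al t : E_ t).
Proof. exact: smooth_section_sum. Qed.

Lemma lift_smooth : smooth_section lift.
Proof.
apply: smooth_section_add; first exact: eta_smooth.
exact: comb_smooth lam_smooth zeta_smooth.
Qed.

Lemma Pi_lift t : Pi V (lift t) = eta t.
Proof. by rewrite PiD (Pi_F0 (F_comb _ _)) addr0 Pi_id. Qed.

(** Obtained by differentiating (zeta^al, eta) = 0. *)
Lemma cov_eta_zeta t al : (< zeta al t, D eta t >) = - (< eta t, D (zeta al) t >).
Proof.
apply/eqP; rewrite -addr_eq0 [X in _ + X]metricC addrC; apply/eqP.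
rewrite -(@derive1_metric _ _ _ L _ _ t (@zeta_smooth al) eta_smooth).
rewrite (_ : (fun s => _) = (fun=> 0)) ?derive1_cst//.
apply/funext => s; rewrite metricC; exact: eta_perp (zeta_in_F al s).
Qed.

Lemma cov_lift : D lift = (fun t => D eta t +
  \sum_al (derive1 (lam al) t *: zeta al t + lam al t *: D (zeta al) t)).
Proof.
apply: section_eq => t; rewrite -cov_sum; [|exact: lam_smooth|exact: zeta_smooth].
apply: cov_add; first exact: eta_smooth.
exact: comb_smooth lam_smooth zeta_smooth.
Qed.

Lemma noether_lift be t : noether zeta be lift t =
  \sum_al derive1 (lam al) t * (< zeta al t, zeta be t >)
    - 2 * (< eta t, D (zeta be) t >).
Proof.
rewrite /noether cov_lift metricDl metricDr cov_eta_zeta metric_sumr metric_suml.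
under eq_bigr do rewrite metricDr !metricZr [(< zeta be t, zeta _ t >)]metricC.
under [X in _ - (_ + X)]eq_bigr do rewrite metricZl zeta_isotropic.
rewrite big_split/=; ring.
Qed.

(** The Noether integrals of a lift vanish exactly when [lam] is a primitive
    of twice [dcoef]. *)
Lemma noether_lift0P t : (forall be, noether zeta be lift t = 0) <->
  (forall al, derive1 (lam al) t = 2 * dcoef (eta t) al).
Proof.
have -> : (forall al, derive1 (lam al) t = 2 * dcoef (eta t) al) <->
    (forall al, derive1 (lam al) t =
      gram_sol t (fun be => 2 * (< eta t, D (zeta be) t >)) al).
  suff E al : 2 * dcoef (eta t) al =
      gram_sol t (fun be => 2 * (< eta t, D (zeta be) t >)) al.
    by split=> h al; rewrite h E.
  by rewrite mulr_sumr; apply: eq_bigr => be _; ring.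
rewrite -gram_solP; split=> h be; last by rewrite noether_lift h subrr.
by apply/eqP; rewrite -subr_eq0 -noether_lift h.
Qed.

Lemma dcoef_smooth al : smooth (fun t => dcoef (eta t) al).
Proof.
apply: gram_sol_smooth => be; apply: metric_smooth; first exact: eta_smooth.
exact: cov_zeta_smooth.
Qed.

Lemma Dperp_eta : Dperp V eta =
  (fun t => D eta t + \sum_al dcoef (eta t) al *: zeta al t).
Proof.
apply: section_eq => t; rewrite /Dperp PiE -sumrN; congr (_ + _).
apply: eq_bigr => al _; rewrite -scaleNr; congr (_ *: _).
rewrite /coef /dcoef /gram_sol -sumrN; apply: eq_bigr => be _.
by rewrite metricC cov_eta_zeta; ring.
Qed.

Lemma Dperp_Dperp_eta t : Dperp V (Dperp V eta) t =
  Pi V (D (D eta) t) + \sum_al dcoef (eta t) al *: Dperp V (zeta al) t.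
Proof.
rewrite {1}/Dperp Dperp_eta cov_add; last first.
- exact: comb_smooth dcoef_smooth zeta_smooth.
- exact: cov_smooth eta_smooth.
rewrite cov_sum; [|exact: dcoef_smooth|exact: zeta_smooth].
by rewrite big_split/= !PiD (Pi_F0 (F_comb _ _)) add0r Pi_comb.
Qed.

Hypothesis lam' : forall t al, derive1 (lam al) t = 2 * dcoef (eta t) al.

Lemma cov_cov_lift t : D (D lift) t = D (D eta) t +
  \sum_al (derive1 (derive1 (lam al)) t *: zeta al t +
            derive1 (lam al) t *: D (zeta al) t) +
  \sum_al (derive1 (lam al) t *: D (zeta al) t + lam al t *: D (D (zeta al)) t).
Proof.
have lam'_smooth al : smooth (derive1 (lam al)).
  rewrite (_ : derive1 (lam al) = (fun t => 2 * dcoef (eta t) al)); last first.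
    by apply/funext => s; exact: lam'.
  apply: smooth_onM; [exact: openT|exact: smooth_on_cst|exact: dcoef_smooth].
have s1 := comb_smooth lam'_smooth zeta_smooth.
have s2 := comb_smooth lam_smooth cov_zeta_smooth.
have s0 := cov_smooth eta_smooth.
rewrite cov_lift -(cov_sum _ _ lam'_smooth zeta_smooth).
rewrite -(cov_sum _ _ lam_smooth cov_zeta_smooth).
rewrite -(cov_add s0 s1) -(cov_add (smooth_section_add s0 s1) s2).
congr (D _ t); apply: section_eq => s.
by rewrite -addrA -big_split.
Qed.

Lemma lift_defect t : D (D lift) t - U L t (lift t) =
  D (D eta) t - U L t (eta t)
  + \sum_al derive1 (derive1 (lam al)) t *: zeta al t
  + \sum_al (4 * dcoef (eta t) al) *: D (zeta al) t.
Proof.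
rewrite cov_cov_lift /lift linearD linear_sum/= !big_split/=.
have -> : \sum_al lam al t *: D (D (zeta al)) t =
    \sum_al U L t (lam al t *: zeta al t).
  by apply: eq_bigr => al _; rewrite zeta_solution linearZ.
have -> : \sum_al (4 * dcoef (eta t) al) *: D (zeta al) t =
    \sum_al derive1 (lam al) t *: D (zeta al) t +
    \sum_al derive1 (lam al) t *: D (zeta al) t.
  rewrite -big_split/=; apply: eq_bigr => al _; rewrite -scalerDl lam'.
  by congr (_ *: _); ring.
set a := D (D eta) t; set b := U L t (eta t).
set c := \sum_al _ *: zeta al t; set d := \sum_al _; set e := \sum_al _.
rewrite [_ + (d + e)]addrA opprD [- b - e]addrC addrA addrK -!addrA.
by congr (_ + _); rewrite [RHS]addrC -!addrA.
Qed.

(** When the Noether integrals vanish, the projected Euler-Lagrange defect of a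
    lift is the Euler-Lagrange defect of [eta] in the Routh system: the
    coefficient 4 in [lift_defect] splits as 1 + 3 between [Dperp_Dperp_eta] and
    the Routh potential. *)
Lemma routh_defect t : Pi V (D (D lift) t - U L t (lift t)) =
  Dperp V (Dperp V eta) t - Uperp V zeta t (eta t).
Proof.
rewrite lift_defect !PiD (Pi_F0 (F_comb _ _)) addr0 Pi_comb.
rewrite Dperp_Dperp_eta UperpE// /routh_op.
have -> : \sum_al (4 * dcoef (eta t) al) *: Pi V (D (zeta al) t) =
    \sum_al dcoef (eta t) al *: Dperp V (zeta al) t +
    3 *: \sum_al dcoef (eta t) al *: Dperp V (zeta al) t.
  rewrite scaler_sumr -big_split/=; apply: eq_bigr => al _.
  by rewrite scalerA -scalerDl; congr (_ *: _); ring.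
rewrite -scaleN1r PiZ scaleN1r opprB -!addrA; congr (_ + _).
by rewrite addrC -addrA.
Qed.

End Lift.

(** * Reduction and reconstruction *)

Lemma reduction (xi : bsection L) : solution xi ->
  (forall al t, noether zeta al xi t = 0) ->
  routh_solution V zeta (fun t => Pi V (xi t)).
Proof.
move=> [sx xi_sol] I0; pose eta : bsection L := fun t => Pi V (xi t).
have eta_s : smooth_section eta := Pi_smooth sx.
have eta_p t : Eperp V (eta t) by exact: Pi_perp.
pose lam al t := coef (xi t) al.
have lam_s al : smooth (lam al).
  exact: coef_smooth.
have xiE : xi = lift eta lam.
  by apply: section_eq => t; rewrite /lift /eta PiE subrK.
split; [exact: eta_s|exact: eta_p|move=> t].
apply/eqP; rewrite -subr_eq0 -(routh_defect eta_s eta_p lam_s).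
  by rewrite -xiE xi_sol subrr Pi0.
by move=> s; apply/(noether_lift0P eta_s eta_p lam_s) => be; rewrite -xiE.
Qed.

(** Any choice of primitives of twice [dcoef] lifts a Routh solution. *)
Lemma lift_solution (eta : bsection L) (lam : 'I_k -> R -> R) :
  routh_solution V zeta eta -> (forall al, smooth (lam al)) ->
  (forall al, derive1 (lam al) = (fun t => 2 * dcoef (eta t) al)) ->
  [/\ solution (lift eta lam), forall al t, noether zeta al (lift eta lam) t = 0
    & forall t, eta t = Pi V (lift eta lam t)].
Proof.
move=> [eta_s eta_p eta_sol] lam_s lam'.
have I0 al t : noether zeta al (lift eta lam) t = 0.
  by move: al; apply/(noether_lift0P eta_s eta_p lam_s) => al; rewrite lam'.
split=> [|//|t]; last by rewrite Pi_lift.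
split; first exact: lift_smooth.
move=> t; apply/eqP; rewrite -subr_eq0 -[X in X == _]Pi_id.
  rewrite (routh_defect eta_s eta_p lam_s) ?eta_sol ?subrr// => s al.
  by rewrite lam'.
(* the defect is orthogonal to F, so that projecting it loses nothing *)
apply/EperpP => al; rewrite metricC -derive1_noether; last exact: lift_smooth.
by rewrite (_ : noether zeta al _ = (fun=> 0)) ?derive1_cst//; apply/funext.
Qed.

Lemma reconstruction (eta : bsection L) : routh_solution V zeta eta ->
  let lifts (xi : bsection L) : Prop :=
    [/\ solution xi, forall al t, noether zeta al xi t = 0
      & forall t, eta t = Pi V (xi t)] in
  exists xi : bsection L, lifts xi /\
    forall xi' : bsection L, lifts xi' <-> Gamma V (fun t => xi' t - xi t).
Proof.
move=> eta_routh lifts; have [eta_s eta_p eta_sol] := eta_routh.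
have mu_s al : smooth (fun t => 2 * dcoef (eta t) al).
  by apply: smooth_onM; [exact: openT|exact: smooth_on_cst|exact: dcoef_smooth].
have /choice[lam lamP] al : exists f : R -> R,
    smooth f /\ derive1 f = (fun t => 2 * dcoef (eta t) al).
  by have [f] := smooth_primitive (mu_s al); exists f.
have lam_s al := (lamP al).1; have lam' al := (lamP al).2.
exists (lift eta lam); split; first exact: lift_solution.
move=> xi'; split=> [[[sx xi'_sol] I0 etaE]|].
(* the coordinates of a second lift differ from lam by constants *)
- pose lam2 al t := coef (xi' t) al.
  have lam2_s al : smooth (lam2 al).
    exact: coef_smooth.
  have xi'E : xi' = lift eta lam2.
    by apply: section_eq => t; rewrite /lift etaE PiE subrK.
  have lam2' al t : derive1 (lam2 al) t = 2 * dcoef (eta t) al.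
    apply: (noether_lift0P eta_s eta_p lam2_s t).1 => be.
    by rewrite -xi'E.
  have cst al t : lam2 al t - lam al t = lam2 al 0 - lam al 0.
    have d1 s : derivable (lam2 al) s 1 by exact: smooth_on_derivable (lam2_s al) I.
    have d2 s : derivable (lam al) s 1 by exact: smooth_on_derivable (lam_s al) I.
    apply: (@derive1_eq0_cst _ (fun t => lam2 al t - lam al t)) => s.
      exact: derivableB (d1 s) (d2 s).
    rewrite derive1E (deriveB (d1 s) (d2 s)) -!derive1E lam2' lam'; exact: subrr.
  rewrite [X in Gamma V X](_ : _ =
      fun t => \sum_al (lam2 al 0 - lam al 0) *: zeta al t).
    exact: comb_Gamma.
  apply: section_eq => t; rewrite xi'E /lift opprD addrACA subrr add0r -sumrB.
  by apply: eq_bigr => al _; rewrite -scalerBl cst.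
(* adding constants to lam gives another system of primitives *)
- case: zeta_basis => _ _ /[apply] -[a aE].
  have -> : xi' = lift eta (fun al t => lam al t + a al).
    apply: section_eq => t; apply/eqP.
    rewrite -(subrK (lift eta lam t) (xi' t)) aE addrC /lift -addrA -big_split/=.
    by apply/eqP; congr (_ + _); apply: eq_bigr => al _; rewrite scalerDl.
  apply: (lift_solution eta_routh) => al.
    by apply: smooth_onD; [exact: openT|exact: lam_s|exact: smooth_on_cst].
  have d1 s : derivable (lam al) s 1 by exact: smooth_on_derivable (lam_s al) I.
  have d2 s : derivable (fun=> a al) s (1 : R) by exact: derivable_cst.
  by apply/funext => t; rewrite (derive1D (d1 t) (d2 t)) derive1_cst addr0 lam'.
Qed.

End Reduction.

Theorem theorem6p2 (R : realType) (tau : R) (tau_gt0 : 0 < tau) (m k : nat)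
    (L : lagrangian_system tau m) (V : {vspace phase L})
    (V_fix : forall w, w \in V -> poincare w - w = 0)
    (V_iso : isotropic V) (V_dim : \dim V = k)
    (F_dim : forall t : R, has_dim (@F R tau m L V t) k)
    (zeta : 'I_k -> bsection L) (zeta_basis : Gamma_basis V zeta) :
  (forall xi : bsection L, solution xi ->
     (forall al t, noether zeta al xi t = 0) ->
     routh_solution V zeta (fun t => Pi V (xi t)))
  /\
  (forall eta : bsection L, routh_solution V zeta eta ->
     let lifts (xi : bsection L) : Prop :=
       [/\ solution xi, forall al t, noether zeta al xi t = 0
         & forall t, eta t = Pi V (xi t)] in
     exists xi : bsection L, lifts xi /\
       forall xi' : bsection L, lifts xi' <-> Gamma V (fun t => xi' t - xi t)).
Proof.
by split; [exact: reduction|exact: reconstruction].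
Qed.
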